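(* Let $\mathfrak g$ be a complex simple Lie algebra with Cartan subalgebra $\mathfrak h$, positive roots $\Delta^+$, simple roots $\Pi$, Chevalley base $\{\mathrm x_\alpha\}_{\alpha\in\Delta}$ and coroots $\mathrm h_\alpha$, and let $\sigma$ be the associated (Kostant--Hitchin) involution of $\mathfrak g$. Let $\eta$ be the longest root. Then $$\sigma(\mathrm x_\eta)=-\mathrm x_\eta,\qquad\sigma(\mathrm h_\eta)=\mathrm h_\eta .$$ Moreover $\sigma$ globally preserves $\mathfrak g_Z$ and $\mathfrak g_{Z^\dagger}$.
   Context: A Chevalley base is a collection of non-zero vectors $\mathrm x_\alpha\in\mathfrak g_\alpha$ ($\alpha\in\Delta$) such that $[\mathrm x_\alpha,\mathrm x_{-\alpha}]=-\mathrm h_\alpha$, $[\mathrm x_\alpha,\mathrm x_\beta]=N_{\alpha,\beta}\mathrm x_{\alpha+\beta}$ with integers $N_{\alpha,\beta}$ when $\alpha+\beta\neq 0$ (with $\mathrm x_{\alpha+\beta}=0$ if $\alpha+\beta$ is not a root), and such that the antilinear map sending $\mathrm x_\alpha$ to $\mathrm x_{-\alpha}$ and each coroot $\mathrm h_\alpha$ to $-\mathrm h_\alpha$ is an antilinear automorphism $\rho$ of $\mathfrak g$. Let $a=\frac12\sum_{\alpha\in\Delta^+}\mathrm h_\alpha=\sum_{\alpha\in\Pi}r_\alpha\mathrm h_\alpha$, $X=\sum_{\alpha\in\Pi}\sqrt{r_\alpha}\,\mathrm x_\alpha$, $Y=\sum_{\alpha\in\Pi}\sqrt{r_\alpha}\,\mathrm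 x_{-\alpha}$; these span a principal subalgebra $\mathfrak s\cong\mathfrak{sl}(2,\mathbb C)$. The involution $\sigma$ is the unique complex linear Lie algebra automorphism of $\mathfrak g$ such that $\sigma=-1$ on $\mathfrak z=\ker(\operatorname{ad}(X))$ and $\sigma(Y)=-Y$; it exists, commutes with $\rho$, and preserves $\mathfrak h$. $\eta$ is the unique positive root such that $\beta+\eta$ is not a root for any positive root $\beta$; $Z^\dagger=\Pi\cup\{-\eta\}$, $Z=-Z^\dagger$, $\mathfrak g_Z=\bigoplus_{\alpha\in Z}\mathfrak g_\alpha$, $\mathfrak g_{Z^\dagger}=\bigoplus_{\alpha\in Z^\dagger}\mathfrak g_\alpha$. *)

(* Defs.v *)
From HB Require Import structures.
From mathcomp Require Import all_boot all_order all_algebra.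
From mathcomp Require Export reals complex.

Set Implicit Arguments.
Unset Strict Implicit.
Unset Printing Implicit Defensive.

Import GRing.Theory Num.Theory.
Local Open Scope ring_scope.

HB.mixin Record Vector_isLieAlgebra (K : fieldType) V of Vector K V := {
  lie_bracket : V -> V -> V;
  lie_bracket_linearl : forall (a : K) (x y z : V),
    lie_bracket (a *: x + y) z = a *: lie_bracket x z + lie_bracket y z;
  lie_bracket_linearr : forall (a : K) (x y z : V),
    lie_bracket x (a *: y + z) = a *: lie_bracket x y + lie_bracket x z;
  lie_bracket_alt : forall x : V, lie_bracket x x = 0;
  lie_bracket_jacobi : forall x y z : V,
    lie_bracket x (lie_bracket y z) + lie_bracket y (lie_bracket z x)
      + lie_bracket z (lie_bracket x y) = 0
}.

(* Finite-dimensional Lie algebras over K. *)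
#[short(type="lieAlgType")]
HB.structure Definition LieAlgebra (K : fieldType) :=
  { V of Vector_isLieAlgebra K V & Vector K V }.

Declare Scope lie_scope.
Delimit Scope lie_scope with lie.
Notation "[ 'lie' x , y ]" := (lie_bracket x y)
  (at level 0, x at level 99, y at level 99, format "[ 'lie'  x ,  y ]")
  : lie_scope.
Local Open Scope lie_scope.

Section LieAlgebra.
Variables (K : fieldType) (g : lieAlgType K).
Implicit Types (U V : {vspace g}) (f : 'End(g)).

HB.instance Definition _ (x : g) :=
  GRing.isLinear.Build K g g *:%R (lie_bracket x)
    (fun a y z => lie_bracket_linearr a x y z).

Definition ad (x : g) : 'End(g) := linfun (lie_bracket x).

Lemma adE (x y : g) : ad x y = [lie x, y].
Proof. by rewrite lfunE. Qed.

Definition lie_ideal U := forall x y : g, y \in U -> [lie x, y] \in U.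

Definition lie_simple :=
  (exists x y : g, [lie x, y] <> 0) /\
  (forall U, lie_ideal U -> U = 0%VS \/ U = fullv).

Definition lie_abelian U :=
  forall x y : g, x \in U -> y \in U -> [lie x, y] = 0.

Definition diagonalizable f :=
  exists2 b : seq g, basis_of fullv b
    & forall v, v \in b -> exists a : K, f v = a *: v.

(* Textbook definition for semisimple Lie algebras over an algebraically closed
   field (e.g. Helgason, III.3): a maximal abelian subalgebra all of whose
   elements are ad-semisimple. An abelian subspace is always a subalgebra. *)
Definition cartan_subalgebra (h : {vspace g}) :=
  [/\ lie_abelian h,
      (forall U, lie_abelian U -> (h <= U)%VS -> U = h)
    & (forall x, x \in h -> diagonalizable (ad x))].

(* [U, V], the span of the brackets. *)
Definition lie_prod U V : {vspace g} :=
  <<[seq [lie u, v] | u <- vbasis U, v <- vbasis V]>>%VS.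

Definition lie_automorphism f :=
  lker f = 0%VS /\ (forall x y : g, f [lie x, y] = [lie f x, f y]).

End LieAlgebra.

Section Roots.
Variables (K : fieldType) (g : lieAlgType K) (h : {vspace g}).

Definition weight := 'Hom(subvs_of h, K^o).
Implicit Types (alpha beta eta : weight) (P : seq weight).

(* The eigenvalue condition is imposed on a basis of h; see root_spaceP. *)
Definition root_space alpha : {vspace g} :=
  (\bigcap_(i < \dim {:subvs_of h})
     lker (ad (vsval (vbasis {:subvs_of h})`_i)
           - (alpha (vbasis {:subvs_of h})`_i : K) *: (\1%VF : 'End(g)))%R)%VS.

Lemma root_spaceP alpha (v : g) :
  v \in root_space alpha <->
  (forall H : subvs_of h, [lie vsval H, v] = (alpha H : K) *: v).
Proof.
split=> [hv H|hv].
  have adZ (c : K) (y z : g) : [lie c *: y + z, v] = c *: [lie y, v] + [lie z, v].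
    exact: lie_bracket_linearl.
  have ad0 : [lie (0 : g), v] = 0.
    by have := adZ (-1) 0 0; rewrite scaler0 addr0 scaleN1r addNr.
  rewrite (coord_vbasis (memvf H)) !linear_sum /= scaler_suml.
  elim/big_rec2: _ => [|i y z _]; first by rewrite ad0.
  rewrite adZ => ->; congr (_ + _).
  rewrite [X in X *: v]linearZ -scalerA; congr (_ *: _).
  move: hv; rewrite memvE /root_space => /subv_bigcapP/(_ i isT).
  rewrite -memvE memv_ker add_lfunE opp_lfunE scale_lfunE id_lfunE adE subr_eq0.
  by move/eqP.
rewrite memvE; apply/subv_bigcapP => i _; rewrite -memvE memv_ker.
by rewrite add_lfunE opp_lfunE scale_lfunE id_lfunE adE hv subrr.
Qed.

Definition is_root alpha := (alpha != 0) && (root_space alpha != 0%VS).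

(* h_alpha is the element of [g_alpha, g_{-alpha}] with alpha(h_alpha) = 2. *)
Definition is_coroot alpha (H : subvs_of h) :=
  vsval H \in lie_prod (root_space alpha) (root_space (- alpha))
  /\ alpha H = 2%:R.

(* The finite set of positive roots is listed without repetition. *)
Definition positive_system P :=
  [/\ uniq P,
      {in P, forall alpha, is_root alpha},
      (forall alpha, is_root alpha -> (alpha \in P) (+) (- alpha \in P))
    & {in P &, forall alpha beta,
         is_root (alpha + beta) -> alpha + beta \in P}].

Definition simple_roots P : seq weight :=
  [seq alpha <- P |
     ~~ has (fun beta => has (fun gamma => alpha == beta + gamma) P) P].

Definition longest_root P eta :=
  eta \in P /\ {in P, forall beta, ~~ is_root (beta + eta)}.

Definition Zdagger P eta : seq weight := - eta :: simple_roots P.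

Definition Zset P eta : seq weight := [seq - alpha | alpha <- Zdagger P eta].

Definition root_sum (S : seq weight) : {vspace g} :=
  (\sum_(alpha <- S) root_space alpha)%VS.

Definition half_sum_coroots P (hc : weight -> subvs_of h) : g :=
  2%:R^-1 *: \sum_(alpha <- P) vsval (hc alpha).

End Roots.

Section Chevalley.
Variables (K : numClosedFieldType) (g : lieAlgType K) (h : {vspace g}).
Implicit Types (P : seq (weight h)) (hc : weight h -> subvs_of h).
Implicit Types (x : weight h -> g) (r : weight h -> K).

Definition antilinear_automorphism (rho : g -> g) :=
  [/\ (forall (c : K) (u v : g), rho (c *: u + v) = c^* *: rho u + rho v),
      (forall u v : g, rho [lie u, v] = [lie rho u, rho v])
    & bijective rho].

(* x is a total function on h^*, extended by 0 outside the roots, which is the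
   convention x_{alpha + beta} = 0 when alpha + beta is not a root. *)
Definition chevalley_base hc x :=
  [/\ (forall alpha, is_root alpha ->
         x alpha \in root_space alpha /\ x alpha != 0),
      (forall alpha, ~~ is_root alpha -> x alpha = 0),
      (forall alpha, is_root alpha ->
         [lie x alpha, x (- alpha)] = - vsval (hc alpha)),
      (exists N : weight h -> weight h -> int,
         forall alpha beta, is_root alpha -> is_root beta ->
           alpha + beta != 0 ->
           [lie x alpha, x beta] = (N alpha beta)%:~R *: x (alpha + beta))
    & (exists rho : g -> g, antilinear_automorphism rho /\
         forall alpha, is_root alpha ->
           rho (x alpha) = x (- alpha) /\
           rho (vsval (hc alpha)) = - vsval (hc alpha))].

(* The r_alpha are positive reals (they are the coefficients of the half-sum of
   positive coroots on the simple coroots), and sqrtC is the usual square root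
   on nonnegative reals. *)
Definition principal_X P r x : g :=
  \sum_(alpha <- simple_roots P) sqrtC (r alpha) *: x alpha.

Definition principal_Y P r x : g :=
  \sum_(alpha <- simple_roots P) sqrtC (r alpha) *: x (- alpha).

Definition kostant_hitchin_involution P r x (sigma : 'End(g)) :=
  [/\ lie_automorphism sigma,
      {in lker (ad (principal_X P r x)), forall z, sigma z = - z}
    & sigma (principal_Y P r x) = - principal_Y P r x].

End Chevalley.

(* Main.v *)
Require Import Defs.
From mathcomp Require Import all_boot all_order all_algebra.
From mathcomp Require Import zify ring.

(** Write [a] for the half sum of the positive coroots, so that [X, Y] = - a.
    Since sigma maps X to - X and Y to - Y, it fixes a. Every simple root takes
    the value 1 on a (the simple reflection permutes the remaining positive roots
    and negates the simple root on their coroots), and the other positive roots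
    take integer values at least 2. Hence ker (ad a) = h and the eigenspaces of
    ad a for 1 and - 1 are the sums of the simple and of the negative simple root
    spaces; all of them are preserved by sigma. As x_eta commutes with X, it is
    sent to - x_eta, so eta is invariant under sigma on h, and sigma preserves the
    line g_{- eta}. The scalar by which it acts there is forced by
    eta (sigma h_eta) = eta (h_eta) = 2. *)

Set Implicit Arguments.
Unset Strict Implicit.
Unset Printing Implicit Defensive.

Import Order.TTheory GRing.Theory Num.Theory.
Local Open Scope ring_scope.
Local Open Scope lie_scope.

(** * Eigenvectors and diagonalisable endomorphisms in finite dimension *)

Section Eigenvectors.
Variables (K : fieldType) (V : vectType K).
Implicit Types (f : 'End(V)) (U W : {vspace V}) (u v w : V).

Lemma subv_big_seq (I : eqType) (s : seq I) (P : pred I) (U : I -> {vspace V}) W :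
  (forall i, i \in s -> P i -> U i <= W)%VS -> (\sum_(i <- s | P i) U i <= W)%VS.
Proof.
move=> sUW; rewrite big_seq_cond; elim/big_rec: _ => [|i X /andP[si Pi] sXW].
  exact: sub0v.
by rewrite subv_add sUW.
Qed.

Lemma sumv_sup_seq (I : eqType) (s : seq I) (P : pred I) (U : I -> {vspace V}) i :
  i \in s -> P i -> (U i <= \sum_(j <- s | P j) U j)%VS.
Proof.
elim: s => //= j s IHs; rewrite inE big_cons => /predU1P[<- Pi|si Pi].
  by rewrite Pi addvSl.
case: ifP => // _; last exact: IHs.
by apply: subv_trans (addvSr _ _); apply: IHs.
Qed.

Section Eigenspaces.
Variables (f : 'End(V)) (I : eqType) (U : I -> {vspace V}) (e : I -> K).
Hypothesis fU : forall i u, u \in U i -> f u = e i *: u.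

Lemma sum_eigen_stable s : {homo f : w / w \in (\sum_(i <- s) U i)%VS}.
Proof.
elim: s => [|i s IHs] w; first by rewrite big_nil memv0 => /eqP->; rewrite linear0 mem0v.
rewrite big_cons => /memv_addP[u uU [v vS ->]].
by rewrite linearD /= memv_add ?IHs // (fU uU) memvZ.
Qed.

(** Write [w = u + v] with [u] in the first space: [(c - e i) w = f v - e i v] then lies in the sum
    of the other spaces, so induction applies. The values [e i] may repeat, and [U i] may be smaller
    than an eigenspace. *)
Lemma sum_eigen_neq s w c :
    {in s, forall i, e i != c} ->
  w \in (\sum_(i <- s) U i)%VS -> f w = c *: w -> w = 0.
Proof.
elim: s w => [|i s IHs] w ne; first by rewrite big_nil memv0 => /eqP.
rewrite big_cons => /memv_addP[u uU [v vS w_def]] fw.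
have nec : c - e i != 0 by rewrite subr_eq0 eq_sym ne ?mem_head.
suffices /eqP : (c - e i) *: w = 0 by rewrite scaler_eq0 (negPf nec) => /eqP.
apply: IHs => [j sj||]; first by rewrite ne // inE sj orbT.
  rewrite scalerBl -fw w_def linearD /= (fU uU) scalerDr opprD addrACA subrr add0r.
  by rewrite memvB ?memvZ // sum_eigen_stable.
by rewrite linearZ /= fw !scalerA mulrC.
Qed.

Lemma sum_eigen_eq s w c :
    w \in (\sum_(i <- s) U i)%VS -> f w = c *: w ->
  w \in (\sum_(i <- s | e i == c) U i)%VS.
Proof.
rewrite (bigID (fun i => e i == c)) /= => /memv_addP[u uU [v vU w_def]] fw.
suffices v0 : v = 0 by rewrite w_def v0 addr0.
have fu : f u = c *: u.
  have: u \in lker (f - c *: \1%VF).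
    move: (u) uU; apply/subvP; apply: subv_big_seq => i _ /eqP ei; apply/subvP=> y yU.
    by rewrite memv_ker add_lfunE opp_lfunE scale_lfunE id_lfunE (fU yU) ei subrr.
  by rewrite memv_ker add_lfunE opp_lfunE scale_lfunE id_lfunE subr_eq0 => /eqP.
apply: (@sum_eigen_neq [seq i <- s | e i != c] v c).
- by move=> i; rewrite mem_filter => /andP[].
- by rewrite big_filter.
by rewrite -[v](addKr u) -w_def linearD linearN /= fw fu scalerDr scalerN.
Qed.

End Eigenspaces.

(** Nonzero eigenvectors for distinct eigenvalues are independent, so there are at most [\dim {:V}]
    of them. Finite dimension enters the [sl(2)] arguments in this form. *)
Lemma distinct_eigen_vanish f (u : nat -> V) (c : nat -> K) :
  injective c -> (forall k, f (u k) = c k *: u k) -> exists k, u k == 0.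
Proof.
move=> c_inj fu; pose n0 := (\dim {:V}).+1.
have [/hasP[k _]|/hasPn nz] := boolP (has (fun k => u k == 0) (iota 0 n0)).
  by exists k.
(* The reversal puts the newest vector at the head, where [free_cons] expects it. *)
pose s n := [seq u k | k <- rev (iota 0 n)].
have s_free n : (n <= (\dim {:V}).+1)%N -> free (s n).
  elim: n => [|n IHn] ltn; first by rewrite /s nil_free.
  rewrite /s -addn1 iotaD rev_cat /= free_cons IHn 1?ltnW // andbT.
  apply/negP; rewrite span_def big_map => un.
  have := nz n; rewrite mem_iota /= add0n => /(_ ltn) /eqP; apply.
  apply: (@sum_eigen_neq f _ (fun k => <[u k]>%VS) c) un (fu n).
    by move=> k y /vlineP[t ->]; rewrite linearZ /= fu !scalerA mulrC.
  move=> k; rewrite mem_rev mem_iota add0n => /andP[_ ltkn].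
  by apply: contraTneq ltkn => /c_inj->; rewrite ltnn.
have := s_free _ (leqnn _); rewrite /free => /eqP dim_s.
have := dimvS (subvf <<s (\dim {:V}).+1>>); rewrite dim_s size_map size_rev size_iota.
by rewrite ltnn.
Qed.

(** The monic polynomial with roots [s], evaluated at [f] and applied to [w]. The left fold absorbs
    the first factor into the argument, as induction on [s] requires. *)
Definition shift_prod f (s : seq K) w := foldl (fun v c => f v - c *: v) w s.

Lemma shift_prod_sum f s w1 w2 t :
  shift_prod f s (t *: w1 + w2) = t *: shift_prod f s w1 + shift_prod f s w2.
Proof.
elim: s w1 w2 => //= c s IHs w1 w2; rewrite -IHs; congr shift_prod.
by rewrite linearP /= !scalerDr !scalerN !scalerA opprD addrACA (mulrC c).
Qed.

Lemma shift_prod0 f s : shift_prod f s 0 = 0.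
Proof. by elim: s => //= c s IHs; rewrite linear0 scaler0 subr0. Qed.

Lemma shift_prod_eigen f s w d :
  d \in s -> f w = d *: w -> shift_prod f s w = 0.
Proof.
move=> sd; elim: s w sd => //= c s IHs w; rewrite inE => /predU1P[->|sd] fw.
  by rewrite fw subrr shift_prod0.
by apply: IHs => //; rewrite fw -scalerBl linearZ /= fw !scalerA mulrC.
Qed.

(** Keeping each eigenvalue of the basis only once gives an annihilating polynomial with simple
    roots, as partial fractions require. *)
Lemma diagonalizable_shift_prod f :
  (exists2 b : seq V, basis_of fullv b
     & forall v, v \in b -> exists a : K, f v = a *: v) ->
  exists2 s, uniq s & forall w, shift_prod f s w = 0.
Proof.
case=> b b_basis b_eigen.
have [s s_eigen] : exists s : seq K,
    forall v, v \in b -> exists2 d, d \in s & f v = d *: v.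
  elim: b b_eigen {b_basis} => [|v b IHb] eig; first by exists [::].
  have [|s hs] := IHb; first by move=> w bw; apply: eig; rewrite inE bw orbT.
  have [a fv] := eig v (mem_head _ _); exists (a :: s) => w; rewrite inE => /predU1P[->|bw].
    by exists a; rewrite ?mem_head.
  by have [d sd fw] := hs w bw; exists d; rewrite ?inE ?sd ?orbT.
exists (undup s) => [|w]; first exact: undup_uniq.
have : w \in <<b>>%VS by rewrite (span_basis b_basis) memvf.
rewrite span_def big_seq; elim/big_rec: _ w => [|v U bv IHU] w.
  by rewrite memv0 => /eqP->; rewrite shift_prod0.
case/memv_addP => y /vlineP[t ->] [z zU ->].
have [d sd fv] := s_eigen v bv.
by rewrite shift_prod_sum (IHU z zU) (shift_prod_eigen _ fv) ?mem_undup // scaler0 addr0.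
Qed.

(* Partial fractions: if (f - c) w is the sum of the u_d with d != c, then
   w - \sum_d u_d / (d - c) is killed by f - c. *)
Lemma stable_eigen_decomp f W s w (S : {vspace V}) :
    uniq s -> {homo f : u / u \in W} -> shift_prod f s w = 0 -> w \in W ->
    (forall u c, u \in W -> f u = c *: u -> u \in S) ->
  w \in S.
Proof.
move=> s_uniq fW w0 wW eigS.
suffices: exists2 u : K -> V, (forall c, u c \in W /\ f (u c) = c *: u c)
             & w = \sum_(c <- s) u c.
  case=> u hu ->; rewrite memv_suml // => c _; have [uW fu] := hu c; exact: eigS uW fu.
elim: s w s_uniq w0 wW => [|c s IHs] w /=.
  move=> _ -> _; exists (fun=> 0) => [c|]; last by rewrite big_nil.
  by rewrite mem0v linear0 scaler0.
case/andP=> sNc s_uniq w0 wW; have [|u hu wE] := IHs _ s_uniq w0.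
  by rewrite memvB ?memvZ ?fW.
pose u' d := if d == c then w - \sum_(e <- s) (e - c)^-1 *: u e else (d - c)^-1 *: u d.
have sumu' : \sum_(e <- s) u' e = \sum_(e <- s) (e - c)^-1 *: u e.
  by rewrite !big_seq; apply: eq_bigr => d sd; rewrite /u' ifN //; apply: contraNneq sNc => <-.
exists u' => [d|]; last by rewrite big_cons sumu' /u' eqxx subrK.
rewrite /u'; case: eqP => [->|_]; last first.
  have [uW fu] := hu d; rewrite memvZ // linearZ /= fu !scalerA mulrC; split=> //.
split.
  by rewrite memvB // memv_suml // => e _; rewrite memvZ; case: (hu e).
have fw : f w = \sum_(e <- s) u e + c *: w by rewrite -wE subrK.
rewrite linearB /= linear_sum scalerBr scaler_sumr fw [_ + c *: w]addrC -addrA; congr (_ + _).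
rewrite -sumrB -sumrN !big_seq; apply: eq_bigr => e se.
have nz : e - c != 0 by rewrite subr_eq0; apply: contraNneq sNc => <-.
have [_ fu] := hu e; rewrite linearZ /= fu !scalerA -{1}(scale1r (u e)) -scalerBl -scaleNr.
by congr (_ *: _); field.
Qed.

End Eigenvectors.

(** * Bracket calculus *)

Section LieBracket.
Variables (K : fieldType) (g : lieAlgType K).
Implicit Types (a b : g) (c : K).

Lemma lieDl a1 a2 b : [lie a1 + a2, b] = [lie a1, b] + [lie a2, b].
Proof. by have := lie_bracket_linearl 1 a1 a2 b; rewrite !scale1r. Qed.

Lemma lie0l b : [lie (0 : g), b] = 0.
Proof. by have /eqP := lieDl 0 0 b; rewrite addr0 -subr_eq subrr eq_sym => /eqP. Qed.

Lemma lieZl c a b : [lie c *: a, b] = c *: [lie a, b].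
Proof. by have := lie_bracket_linearl c a 0 b; rewrite addr0 lie0l addr0. Qed.

Lemma lieZr c a b : [lie a, c *: b] = c *: [lie a, b].
Proof. exact: linearZ. Qed.

Lemma lieNl a b : [lie - a, b] = - [lie a, b].
Proof. by rewrite -scaleN1r lieZl scaleN1r. Qed.

Lemma lieC a b : [lie a, b] = - [lie b, a].
Proof.
apply/eqP; rewrite -addr_eq0; apply/eqP; have := lie_bracket_alt (a + b).
by rewrite linearD /= !lieDl !lie_bracket_alt add0r addr0 addrC.
Qed.

Lemma lie_der a b d : [lie a, [lie b, d]] = [lie [lie a, b], d] + [lie b, [lie a, d]].
Proof.
apply/eqP; rewrite -subr_eq0; have := lie_bracket_jacobi a b d.
rewrite (lieC d a) (lieC d [lie a, b]) linearN /= => <-.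
by rewrite opprD [- _ - _]addrC addrA.
Qed.

Lemma lie_suml (I : Type) (s : seq I) (F : I -> g) b :
  [lie \sum_(i <- s) F i, b] = \sum_(i <- s) [lie F i, b].
Proof.
elim: s => [|i s IHs]; first by rewrite !big_nil lie0l.
by rewrite !big_cons lieDl IHs.
Qed.

Lemma lie_iter_weight (H a b : g) (c d : K) k :
  [lie H, a] = c *: a -> [lie H, b] = d *: b ->
  [lie H, iter k (lie_bracket a) b] = (d + c *+ k) *: iter k (lie_bracket a) b.
Proof.
move=> Ha Hb; elim: k => [|k IHk]; first by rewrite mulr0n addr0.
by rewrite iterS lie_der Ha IHk lieZl linearZ /= -scalerDl mulrS addrCA.
Qed.

End LieBracket.

(** * Representations of [sl(2)], with the sign [[e, f] = - H] of a Chevalley base *)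

Section Sl2.
Variables (K : numFieldType) (g : lieAlgType K) (e f H : g).
Hypothesis (He : [lie H, e] = 2 *: e) (Hf : [lie H, f] = - 2 *: f).
Hypothesis ef : [lie e, f] = - H.

Let addM_inj (d c : K) : c != 0 -> injective (fun k => d + c *+ k).
Proof. by move=> c0 k l /addrI /(mulrIn c0). Qed.

(** The iterates have the pairwise distinct weights [d + c *+ k], so they cannot all be nonzero. *)
Lemma lie_iter_vanish (u v : g) (c d : K) :
    c != 0 -> [lie H, u] = c *: u -> [lie H, v] = d *: v -> v != 0 ->
  exists p, iter p (lie_bracket u) v != 0 /\ iter p.+1 (lie_bracket u) v = 0.
Proof.
move=> c0 Hu Hv v0.
have [|k] := @distinct_eigen_vanish _ _ (ad H)
    (fun k => iter k (lie_bracket u) v) _ (@addM_inj d c c0).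
  by move=> k; rewrite adE; apply: lie_iter_weight.
elim: k => [|k IHk]; first by rewrite /= (negPf v0).
have [/IHk//|nz /eqP z] := boolP (iter k (lie_bracket u) v == 0).
by exists k.
Qed.

(** Induction gives [e f^(k+1) v = - (k+1) (d - k) f^k v]. If [f^m v] is the last nonzero power, the
    case [k = m] forces [d = m]. *)
Lemma highest_weight_nat (v : g) (d : K) :
    v != 0 -> [lie e, v] = 0 -> [lie H, v] = d *: v ->
  exists2 m : nat, d = m%:R
    & forall k, (k <= m)%N -> iter k (lie_bracket f) v != 0.
Proof.
move=> v0 ev Hv.
have Efk k : [lie e, iter k.+1 (lie_bracket f) v]
           = - (k.+1%:R * (d - k%:R)) *: iter k (lie_bracket f) v.
  have Hk l := lie_iter_weight l Hf Hv.
  elim: k => [|k IHk].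
    by rewrite /= lie_der ev linear0 addr0 ef lieNl Hv mul1r subr0 scaleNr.
  rewrite iterS lie_der ef lieNl Hk IHk lieZr /= -scaleNr -scalerDl.
  by congr (_ *: _); rewrite -mulr_natr -!natr1; ring.
have [|m [nz z]] := lie_iter_vanish _ Hf Hv v0.
  by rewrite oppr_eq0 pnatr_eq0.
exists m.
  have /eqP := Efk m; rewrite z linear0 eq_sym scaler_eq0 (negPf nz) orbF.
  by rewrite oppr_eq0 mulf_eq0 pnatr_eq0 /= subr_eq0 => /eqP.
move=> k lekm; apply: contraNneq nz => z'; rewrite -(subnK lekm) iterD z'.
by elim: (m - k)%N => //= l /eqP->; rewrite linear0.
Qed.

(** From [e f y = 0], induction gives [f e^(k+1) y = (k+1) (d + k) e^k y] with positive
    coefficients. Were [y] nonzero, no power of [e] would kill it, against finite dimension. *)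
Lemma lower_raise_eq0 (y : g) (d : K) :
  0 < d -> [lie H, y] = d *: y -> [lie e, [lie f, y]] = 0 -> y = 0.
Proof.
move=> d0 Hy efy; apply/eqP/negPn/negP => y0.
have Fek k : [lie f, iter k.+1 (lie_bracket e) y]
           = (k.+1%:R * (d + k%:R)) *: iter k (lie_bracket e) y.
  have fe : [lie f, e] = H by rewrite lieC ef opprK.
  have Hk l := lie_iter_weight l He Hy.
  elim: k => [|k IHk]; first by rewrite /= lie_der efy addr0 fe Hy mul1r addr0.
  rewrite iterS lie_der fe Hk IHk lieZr /= -scalerDl.
  by congr (_ *: _); rewrite -mulr_natr -!natr1; ring.
have [|m [/negP nz z]] := lie_iter_vanish _ He Hy y0.
  by rewrite pnatr_eq0.
apply: nz; have /eqP := Fek m; rewrite z linear0 eq_sym scaler_eq0.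
by rewrite mulf_eq0 pnatr_eq0 /= gt_eqF // ltr_wpDr.
Qed.

(** Here [p] counts the raisings of [v] up to a highest weight vector, and [m = d + 2p] is the
    weight of that vector. *)
Lemma weight_string (v : g) (d : K) :
    v != 0 -> [lie H, v] = d *: v ->
  exists p m : nat, d = m%:R - 2 * p%:R /\
    forall k, (k <= m)%N -> iter k (lie_bracket f) (iter p (lie_bracket e) v) != 0.
Proof.
move=> v0 Hv; have [|p [nz z]] := lie_iter_vanish _ He Hv v0.
  by rewrite pnatr_eq0.
have [m dE hm] := highest_weight_nat nz z (lie_iter_weight p He Hv).
by exists p, m; split=> //; rewrite -dE mulr_natr addrK.
Qed.

End Sl2.

(** * Root spaces and the root space decomposition *)

Section RootSpaces.
Variables (K : fieldType) (g : lieAlgType K) (h : {vspace g}).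
Implicit Types (alpha beta lam mu : weight h) (u v : g) (H : subvs_of h).

Lemma root_space_weight lam u H :
  u \in root_space lam -> [lie vsval H, u] = (lam H : K) *: u.
Proof. by move/root_spaceP. Qed.

Lemma root_space_lie lam mu u v :
  u \in root_space lam -> v \in root_space mu -> [lie u, v] \in root_space (lam + mu).
Proof.
move=> hu hv; apply/root_spaceP => H.
rewrite lie_der !(root_space_weight _ hu) !(root_space_weight _ hv) lieZl lieZr.
by rewrite -scalerDl add_lfunE.
Qed.

Lemma root_space_iter lam mu u v k :
    u \in root_space lam -> v \in root_space mu ->
  iter k (lie_bracket u) v \in root_space (mu + k%:R *: lam).
Proof.
move=> hu hv; elim: k => [|k IHk]; first by rewrite scale0r addr0.
by rewrite iterS -natr1 scalerDl scale1r addrA addrC root_space_lie.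
Qed.

Hypothesis h_cartan : cartan_subalgebra h.

(** If [v] commutes with [h], then [h + <[v]>] is still abelian, so maximality puts [v] in [h]. *)
Lemma root_space0 : root_space (0 : weight h) = h.
Proof.
have [h_ab h_max _] := h_cartan; apply/eqP; rewrite eqEsubv; apply/andP; split.
  apply/subvP => v v0.
  have hv u : u \in h -> [lie u, v] = 0.
    by move=> hu; rewrite -(vsprojK hu) (root_space_weight _ v0) zero_lfunE scale0r.
  suffices <- : (h + <[v]>)%VS = h by rewrite (subvP (addvSr _ _)) ?memv_line.
  apply: h_max; last exact: addvSl.
  move=> _ _ /memv_addP[a ha [_ /vlineP[c ->] ->]] /memv_addP[b hb [_ /vlineP[d ->] ->]].
  rewrite linearD /= !lieDl !lieZr !lieZl (h_ab a b) // hv // lie_bracket_alt.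
  by rewrite (lieC v) hv // oppr0 !scaler0 !addr0.
apply/subvP => v hv; apply/root_spaceP => H.
by rewrite (h_ab (vsval H) v) ?subvsP // zero_lfunE scale0r.
Qed.

Lemma mem_root_space0 v : (v \in root_space (0 : weight h)) = (v \in h).
Proof. by rewrite root_space0. Qed.

Lemma common_eigenvector_weight v :
    v != 0 ->
    (forall b, b \in vbasis {:subvs_of h} -> exists c : K, [lie vsval b, v] = c *: v) ->
  exists lam : weight h, v \in root_space lam.
Proof.
move=> v0 eig.
have eigH H : exists c : K, [lie vsval H, v] = c *: v.
  have : H \in <<vbasis {:subvs_of h}>>%VS by rewrite (span_basis (vbasisP _)) memvf.
  rewrite span_def big_seq; elim/big_rec: _ H => [|b U bb IHU] H.
    by rewrite memv0 => /eqP->; exists 0; rewrite linear0 lie0l scale0r.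
  case/memv_addP => _ /vlineP[t ->] [z zU ->].
  have [c hc] := eig b bb; have [d hd] := IHU z zU.
  by exists (t * c + d); rewrite linearP /= lieDl lieZl hc hd scalerDl scalerA.
have coordv : coord [tuple v] ord0 v = 1.
  by have := @coord_free _ _ _ [tuple v] ord0 ord0; rewrite /= seq1_free v0 => ->.
(* The eigenvalue on [v] is read off as a coordinate along [v], which makes it linear in [H]; the
   sign comes from [[H, v] = - ad v H]. *)
pose lam : weight h := (linfun (coord [tuple v] ord0 : g -> K^o) \o (- ad v) \o linfun vsval)%VF.
exists lam; apply/root_spaceP => H; have [c Hv] := eigH H.
rewrite !comp_lfunE opp_lfunE adE [linfun vsval _]lfunE -lieC Hv lfunE linearZ /= coordv.
by congr (_ *: _); rewrite [RHS]mulr1.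
Qed.

(* Diagonalise one basis element of h at a time: each ad b is diagonalisable and
   preserves the joint eigenspaces of the elements already treated. *)
Lemma root_space_decomp (S : {vspace g}) :
  (forall lam : weight h, root_space lam <= S)%VS -> S = fullv.
Proof.
move=> hS; apply/eqP; rewrite eqEsubv subvf; apply/subvP => v _.
pose eigen (W : {vspace g}) (b : subvs_of h) :=
  exists c : K, forall u, u \in W -> [lie vsval b, u] = c *: u.
suffices: forall (rest : seq (subvs_of h)) (W : {vspace g}),
     {in vbasis {:subvs_of h}, forall b, b \in rest \/ eigen W b} ->
     (forall (H : subvs_of h) u, u \in W -> [lie vsval H, u] \in W) -> (W <= S)%VS.
  move=> IH; apply: (subvP (IH (vbasis {:subvs_of h}) fullv _ _)) => [b|H u _|].
  - by left.
  - exact: memvf.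
  exact: memvf.
have [h_ab _ h_diag] := h_cartan.
elim=> [|b rest IHrest] W hW stabW; apply/subvP => w wW.
  have [->|w0] := eqVneq w 0; first exact: mem0v.
  have [b bb|lam] := common_eigenvector_weight w0; last exact: (subvP (hS lam)).
  by have [//|[c hc]] := hW b bb; exists c; apply: hc.
have [s s_uniq s0] := diagonalizable_shift_prod (h_diag _ (subvsP b)).
apply: (stable_eigen_decomp s_uniq _ (s0 w) wW) => [u uW|u c uW bu].
  by rewrite adE stabW.
pose W' := (W :&: lker (ad (vsval b) - c *: \1%VF))%VS.
have W'P y : (y \in W') = (y \in W) && ([lie vsval b, y] == c *: y).
  by rewrite memv_cap memv_ker add_lfunE opp_lfunE scale_lfunE id_lfunE adE subr_eq0.
apply: (subvP (IHrest W' _ _)); last by rewrite W'P uW -bu adE eqxx.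
  move=> b' bb'; have [|[d hd]] := hW b' bb'.
    rewrite inE => /predU1P[->|]; last by left.
    by right; exists c => y; rewrite W'P => /andP[_ /eqP].
  by right; exists d => y; rewrite W'P => /andP[/hd].
move=> H y; rewrite !W'P => /andP[yW /eqP yc]; rewrite stabW //=.
by rewrite lie_der (h_ab (vsval b) (vsval H)) ?subvsP // lie0l add0r yc lieZr.
Qed.

End RootSpaces.

(** * Roots and the [sl(2)] triples of a Chevalley base *)

Section RootSystem.
Variables (K : numClosedFieldType) (g : lieAlgType K) (h : {vspace g}).
Variables (P : seq (weight h)) (hc : weight h -> subvs_of h) (x : weight h -> g).
Hypotheses (h_cartan : cartan_subalgebra h) (P_positive : positive_system P).
Hypothesis hc_coroot : forall alpha, is_root alpha -> is_coroot alpha (hc alpha).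
Hypothesis x_chevalley : chevalley_base hc x.
Implicit Types (alpha beta gamma lam mu : weight h) (u v y : g) (H : subvs_of h).

Lemma weightBZ lam H H' (c : K) : lam (H - c *: H') = lam H - c * lam H' :> K.
Proof. by rewrite -scaleNr addrC linearP /= addrC [_ *: _]mulNr. Qed.

Lemma coroot2 alpha : is_root alpha -> alpha (hc alpha) = 2 :> K.
Proof. by case/hc_coroot. Qed.

Lemma xP alpha : is_root alpha -> x alpha \in root_space alpha.
Proof. by have [/(_ alpha) xr _ _ _ _] := x_chevalley => /xr[]. Qed.

Lemma x_neq0 alpha : is_root alpha -> x alpha != 0.
Proof. by have [/(_ alpha) xr _ _ _ _] := x_chevalley => /xr[]. Qed.

Lemma lie_xx alpha : is_root alpha -> [lie x alpha, x (- alpha)] = - vsval (hc alpha).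
Proof. by have [_ _ xx _ _] := x_chevalley; apply: xx. Qed.

Lemma coroot_neq0 alpha : is_root alpha -> hc alpha != 0.
Proof.
move=> ra; apply/eqP => h0; have := coroot2 ra; rewrite h0 linear0 => /esym/eqP.
by rewrite pnatr_eq0.
Qed.

Lemma root_neq0 alpha : is_root alpha -> alpha != 0.
Proof. by case/andP. Qed.

(** If [- alpha] were not a root, then [x (- alpha) = 0] by convention, and [[x alpha, x (- alpha)]
    = - h_alpha] would make the coroot zero. *)
Lemma rootN alpha : is_root alpha -> is_root (- alpha).
Proof.
have [_ x0 _ _ _] := x_chevalley.
move=> ra; apply: contraT => nr; have /eqP := lie_xx ra.
rewrite (x0 _ nr) linear0 eq_sym oppr_eq0 -[0]/(vsval (0 : subvs_of h)).
by rewrite (inj_eq subvs_inj) (negPf (coroot_neq0 ra)).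
Qed.

Lemma corootN alpha : is_root alpha -> hc (- alpha) = - hc alpha.
Proof.
move=> ra; apply: subvs_inj; have := lie_xx (rootN ra); rewrite opprK lieC lie_xx //.
by move=> /oppr_inj <-; rewrite linearN.
Qed.

Lemma root_space_root u lam : u != 0 -> u \in root_space lam -> lam != 0 -> is_root lam.
Proof.
move=> u0 ul l0; rewrite /is_root l0 /=; apply: contraNneq u0 => e.
by rewrite e memv0 in ul.
Qed.

Lemma lie_coroot_x alpha : is_root alpha -> [lie vsval (hc alpha), x alpha] = 2 *: x alpha.
Proof. by move=> ra; rewrite (root_space_weight _ (xP ra)) coroot2. Qed.

Lemma lie_coroot_xN alpha :
  is_root alpha -> [lie vsval (hc alpha), x (- alpha)] = - 2 *: x (- alpha).
Proof. by move=> ra; rewrite (root_space_weight _ (xP (rootN ra))) opp_lfunE coroot2. Qed.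

(** The top of the string is [beta + p alpha], and [k] counts the steps down from it. The guard
    [lam != 0] is there because the string of [beta = alpha] or [- alpha] passes through 0. *)
Lemma root_string alpha beta :
    is_root alpha -> is_root beta ->
  exists p m : nat, (beta (hc alpha) : K) = m%:R - 2 * p%:R /\
    forall k, (k <= m)%N -> let lam := beta + (p%:R - k%:R) *: alpha in
      lam != 0 -> is_root lam.
Proof.
move=> ra rb.
have [p [m [bE hk]]] := weight_string (lie_coroot_x ra) (lie_coroot_xN ra) (lie_xx ra)
  (x_neq0 rb) (root_space_weight _ (xP rb)).
exists p, m; split=> // k lekm; apply: root_space_root (hk k lekm) _.
rewrite scalerBl addrA -scalerN; apply: root_space_iter; first exact: xP (rootN ra).
exact: root_space_iter (xP ra) (xP rb).
Qed.

(** In this case [x beta] is a highest weight vector for the triple of [alpha]. *)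
Lemma nonroot_coroot_nat alpha beta :
    is_root alpha -> is_root beta -> alpha + beta != 0 -> ~~ is_root (alpha + beta) ->
  exists m : nat, (beta (hc alpha) : K) = m%:R.
Proof.
move=> ra rb ab0 nr; have xab : [lie x alpha, x beta] = 0.
  apply/eqP; apply: contraNT nr => nz.
  by apply: root_space_root nz _ ab0; apply: root_space_lie; apply: xP.
have [m mE _] := highest_weight_nat (lie_coroot_xN ra) (lie_xx ra)
  (x_neq0 rb) xab (root_space_weight _ (xP rb)).
by exists m.
Qed.

(** Subtract from [v] a multiple of [x alpha] so that lowering the difference [y] lands in the
    kernel of [alpha] on [h]. Raising again then gives 0, and [lower_raise_eq0] yields [y = 0]. *)
Lemma root_space_line alpha v :
  is_root alpha -> v \in root_space alpha -> exists c, v = c *: x alpha.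
Proof.
move=> ra va; have rNa := rootN ra.
have fv : [lie x (- alpha), v] \in h.
  by rewrite -(mem_root_space0 h_cartan) -(addNr alpha) root_space_lie ?xP.
(* Lowering [x alpha] gives [h_alpha], on which [alpha] takes the value 2; hence the factor
   [t / 2]. *)
pose t : K := alpha (vsproj h [lie x (- alpha), v]); exists (t / 2).
apply/eqP; rewrite -subr_eq0; apply/eqP; set y := v - _.
have ya : y \in root_space alpha by rewrite memvB ?memvZ ?xP.
apply: (lower_raise_eq0 (lie_coroot_x ra) (lie_xx ra) (d := 2)) => //.
  by rewrite (root_space_weight _ ya) coroot2.
have -> : [lie x (- alpha), y]
        = vsval (vsproj h [lie x (- alpha), v] - (t / 2) *: hc alpha).
  rewrite /y -!scaleNr linearD [RHS]linearD /= lieZr (vsprojK fv); congr (_ + _ *: _).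
  by rewrite lieC lie_xx // opprK.
rewrite lieC (root_space_weight _ (xP ra)) weightBZ coroot2 // -/t mulfVK ?pnatr_eq0 //.
by rewrite subrr scale0r oppr0.
Qed.

(** Lowering from [(k+2) alpha] lands in the line of [x alpha] when [k = 0], and gives 0 for larger
    [k] by induction. Raising again gives 0 either way, and [lower_raise_eq0] applies. *)
Lemma root_multiple alpha k : is_root alpha -> ~~ is_root (k.+2%:R *: alpha).
Proof.
move=> ra; rewrite /is_root negb_and !negbK; apply/orP; right.
have rNa := rootN ra.
have low y l : y \in root_space (l.+1%:R *: alpha) ->
    [lie x (- alpha), y] \in root_space (l%:R *: alpha).
  have -> : l%:R *: alpha = - alpha + l.+1%:R *: alpha.
    by rewrite -natr1 scalerDl scale1r addrC addrK.
  by apply: root_space_lie; apply: xP.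
suffices hk y : y \in root_space (k.+2%:R *: alpha) -> [lie x alpha, [lie x (- alpha), y]] = 0.
  rewrite -subv0; apply/subvP => y hy; rewrite memv0; apply/eqP.
  apply: (lower_raise_eq0 (lie_coroot_x ra) (lie_xx ra) (d := k.+2%:R * 2)).
  - by rewrite mulr_gt0 ?ltr0n.
  - by rewrite (root_space_weight _ hy) scale_lfunE coroot2.
  exact: hk.
elim: k y => [|k IHk] y /low.
  rewrite scale1r => /(root_space_line ra)[c ->].
  by rewrite lieZr lie_bracket_alt scaler0.
move=> hy; rewrite [[lie x (- alpha), y]](_ : _ = 0) ?linear0 //.
apply: (lower_raise_eq0 (lie_coroot_x ra) (lie_xx ra) (d := k.+2%:R * 2)).
- by rewrite mulr_gt0 ?ltr0n.
- by rewrite (root_space_weight _ hy) scale_lfunE coroot2.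
exact: IHk.
Qed.

(** The string runs without gaps from [beta] to its reflection. Raising by [alpha] settles the case
    [2p <= m]; otherwise [beta (hc alpha)] is negative and the string for [- alpha] is used. *)
Lemma root_chain alpha beta :
    is_root alpha -> is_root beta ->
  (exists2 n : nat, (beta (hc alpha) : K) = n%:R & forall j, (j <= n)%N ->
     beta - j%:R *: alpha != 0 -> is_root (beta - j%:R *: alpha)) \/
  (exists2 n : nat, (beta (hc alpha) : K) = - n%:R & forall j, (j <= n)%N ->
     beta + j%:R *: alpha != 0 -> is_root (beta + j%:R *: alpha)).
Proof.
move=> ra rb; have [p [m [bE hk]]] := root_string ra rb.
case: (leqP (2 * p) m) => lepm; [left | right].
  exists (m - 2 * p)%N => [|j lej]; first by rewrite natrB // natrM.
  have := hk (p + j)%N; rewrite natrD opprD addrA subrr add0r scaleNr; apply; lia.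
have [p' [m' [bE' hk']]] := root_string (rootN ra) rb.
move: bE'; rewrite corootN // linearN /= => /(canRL (@opprK _)) bE'.
have lepm' : (2 * p' <= m')%N.
  have : (m' + m)%:R = (2 * p' + 2 * p)%:R :> K.
    rewrite (natrD _ m') (natrD _ (2 * p')) !natrM.
    by rewrite -[m%:R](subrK (2 * p%:R)) -bE bE'; ring.
  by move/eqP; rewrite eqr_nat => /eqP; lia.
exists (m' - 2 * p')%N => [|j lej]; first by rewrite bE' natrB // natrM.
have := hk' (p' + j)%N; rewrite natrD opprD addrA subrr add0r scaleNr scalerN opprK.
apply; lia.
Qed.

(** * Reflections and finiteness of the set of roots *)

Definition reflection alpha (H : subvs_of h) lam : weight h := lam - (lam H : K) *: alpha.

Lemma reflectionE alpha H lam H' :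
  reflection alpha H lam H' = lam H' - lam H * alpha H' :> K.
Proof. by rewrite /reflection add_lfunE opp_lfunE scale_lfunE. Qed.

Lemma reflectionK alpha H : alpha H = 2 :> K -> involutive (reflection alpha H).
Proof.
move=> aH lam; apply/lfunP => H'; rewrite !reflectionE aH.
by rewrite -[RHS]/(lam H' : K); ring.
Qed.

Lemma root_reflection alpha beta :
  is_root alpha -> is_root beta -> is_root (reflection alpha (hc alpha) beta).
Proof.
move=> ra rb.
have nz : reflection alpha (hc alpha) beta != 0.
  have: beta != 0 by apply: root_neq0.
  apply: contraNneq => e; rewrite -(reflectionK (coroot2 ra) beta) e.
  by rewrite /reflection zero_lfunE scale0r subr0.
have [[n bE hn]|[n bE hn]] := root_chain ra rb; have := hn n (leqnn n).
  by rewrite -bE; apply.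
by rewrite -[n%:R]opprK -bE scaleNr; apply.
Qed.

Lemma weightN lam H : (- lam) H = - lam H :> K.
Proof. by rewrite opp_lfunE. Qed.

Lemma weightDZ lam mu (c : K) H : (lam + c *: mu) H = lam H + c * mu H :> K.
Proof. by rewrite add_lfunE scale_lfunE. Qed.

Lemma root_mem alpha : is_root alpha -> alpha \in P ++ [seq - beta | beta <- P].
Proof.
have [_ _ /(_ alpha) P_part _] := P_positive; move=> /P_part; rewrite mem_cat.
case: (alpha \in P) => //= ma; rewrite -[alpha]opprK map_f //.
Qed.

Lemma root_finite (u : nat -> weight h) : (forall k, is_root (u k)) -> ~ injective u.
Proof.
move=> ru u_inj; pose D := P ++ [seq - beta | beta <- P].
have u_uniq : uniq [seq u k | k <- iota 0 (size D).+1].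
  by rewrite map_inj_uniq ?iota_uniq.
have /(uniq_leq_size u_uniq) : {subset [seq u k | k <- iota 0 (size D).+1] <= D}.
  by move=> _ /mapP[k _ ->]; apply: root_mem.
by rewrite size_map size_iota ltnn.
Qed.

(* With gamma the reflected root, s_gamma and s_alpha s_beta s_alpha are two
   reflections along gamma that permute the finitely many roots; their product
   is unipotent of finite order on roots, hence trivial. *)
Lemma coroot_reflection alpha beta :
    is_root alpha -> is_root beta ->
  alpha (hc (reflection alpha (hc alpha) beta)) = - alpha (hc beta) :> K.
Proof.
move=> ra rb; set gamma := reflection _ _ _.
have rg : is_root gamma by apply: root_reflection.
have gE H : gamma H = beta H - beta (hc alpha) * alpha H :> K by apply: reflectionE.
clearbody gamma; have g2 := coroot2 rg.
have bg : beta (hc gamma) = 2 + beta (hc alpha) * alpha (hc gamma) :> K.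
  by rewrite -g2 gE subrK.
(* [H'] is the dual reflection of [hc beta], the expected value of [hc gamma]; [phi] below measures
   the difference of the two, and [phi alpha = 0] is the claim. *)
pose H' := hc beta - (alpha (hc beta) : K) *: hc alpha.
have H'E lam : lam H' = lam (hc beta) - alpha (hc beta) * lam (hc alpha) :> K.
  exact: weightBZ.
clearbody H'; pose s a := reflection a (hc a).
pose T lam := s gamma (s alpha (s beta (s alpha lam))).
pose phi lam : K := lam H' - lam (hc gamma).
have phiD lam mu (c : K) : phi (lam + c *: mu) = phi lam + c * phi mu.
  by rewrite /phi !weightDZ; ring.
have TE lam : T lam = lam + phi lam *: gamma.
  apply/lfunP => H; rewrite /T /s [RHS]weightDZ /phi !reflectionE H'E !gE.
  by rewrite !coroot2 // bg; ring.
have phig : phi gamma = 0.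
  by rewrite /phi g2 H'E !gE !coroot2 //; ring.
have Tk k : iter k T alpha = alpha + (k%:R * phi alpha) *: gamma.
  elim: k => [|k IHk]; first by rewrite mul0r scale0r addr0.
  rewrite iterS IHk TE.
  rewrite phiD phig mulr0 addr0.
  by rewrite -addrA -scalerDl -natr1 mulrDl mul1r.
have rT k : is_root (iter k T alpha).
  elim: k => [//|k IHk]; rewrite iterS.
  exact: (root_reflection rg (root_reflection ra (root_reflection rb (root_reflection ra IHk)))).
have phi0 : phi alpha = 0.
  apply/eqP; apply: contraT => nz; case: (root_finite rT) => k l.
  rewrite !Tk => /addrI /eqP; rewrite -subr_eq0 -scalerBl scaler_eq0 (negPf (root_neq0 rg)) orbF.
  by rewrite -mulrBl mulf_eq0 (negPf nz) orbF subr_eq0 eqr_nat => /eqP.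
by move: phi0 => /subr0_eq <-; rewrite H'E coroot2 //; ring.
Qed.

(** * Positive and simple roots *)

Lemma pos_root alpha : alpha \in P -> is_root alpha.
Proof. by have [_ Pr _ _] := P_positive; apply: Pr. Qed.

Lemma pos_oppF alpha : alpha \in P -> - alpha \notin P.
Proof.
have [_ Pr Pp _] := P_positive; move=> Pa; have := Pp _ (Pr _ Pa).
by rewrite Pa.
Qed.

Lemma pos_add alpha beta :
  alpha \in P -> beta \in P -> is_root (alpha + beta) -> alpha + beta \in P.
Proof. by have [_ _ _ Pc] := P_positive; apply: Pc. Qed.

Lemma root_posVneg alpha : is_root alpha -> alpha \in P \/ - alpha \in P.
Proof.
have [_ _ Pp _] := P_positive; move/Pp.
by case: (alpha \in P) => /=; [left | right].
Qed.

Lemma pos_add_neq0 alpha beta : alpha \in P -> beta \in P -> alpha + beta != 0.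
Proof.
move=> Pa Pb; apply: contraL Pb => /eqP /(canRL (addKr _)); rewrite addr0 => ->.
exact: pos_oppF.
Qed.

(** Two terms [b] and [a] whose sum is a root are merged, which shortens the list. If [b] merges
    with no other term, each of the others takes a natural value on [hc b], so the sum takes a value
    at least 2 there. *)
Lemma pos_sum_neq0 (s : seq (weight h)) :
  s != [::] -> {subset s <= P} -> \sum_(alpha <- s) alpha != 0.
Proof.
have [n] := ubnP (size s); elim: n s => // n IHn [//|b s] /= ltsn _ sP.
have Pb : b \in P by rewrite sP ?mem_head.
have sP' : {subset s <= P} by move=> a sa; rewrite sP // inE sa orbT.
have [/hasP[a sa rab]|/hasPn nr] := boolP (has (fun a => is_root (b + a)) s).
  have -> : \sum_(c <- b :: s) c = \sum_(c <- b + a :: rem a s) c.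
    by rewrite !big_cons (big_rem a sa) /= addrA.
  apply: IHn => //=; first by rewrite size_rem // prednK //; case: (s) sa.
  move=> c; rewrite inE => /predU1P[->|/mem_rem/sP'//].
  by apply: pos_add => //; apply: sP'.
apply/eqP => sum0.
have : exists m : nat, (\sum_(a <- s) a) (hc b) = m%:R :> K.
  elim: s sP' nr {sP ltsn sum0} => [|a s IHs] sP nr.
    by exists 0%N; rewrite big_nil zero_lfunE.
  have [||m mE] := IHs; first by move=> c sc; rewrite sP // inE sc orbT.
    by move=> c sc; rewrite nr // inE sc orbT.
  have Pa : a \in P by rewrite sP ?mem_head.
  have [l lE] := nonroot_coroot_nat (pos_root Pb) (pos_root Pa) (pos_add_neq0 Pb Pa)
    (nr a (mem_head _ _)).
  by exists (l + m)%N; rewrite big_cons add_lfunE lE mE natrD.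
case=> m mE; have : (b + \sum_(a <- s) a) (hc b) = 0 :> K.
  by move: sum0; rewrite big_cons => ->; rewrite zero_lfunE.
rewrite add_lfunE mE coroot2 ?pos_root // -[_ + _]/((2 : K) + m%:R).
by rewrite -natrD => /eqP; rewrite pnatr_eq0.
Qed.

Lemma simple_pos alpha : alpha \in simple_roots P -> alpha \in P.
Proof. by rewrite mem_filter => /andP[]. Qed.

Lemma simple_indecomp alpha beta gamma :
  alpha \in simple_roots P -> beta \in P -> gamma \in P -> alpha != beta + gamma.
Proof.
rewrite mem_filter => /andP[/hasPn /(_ beta) ind _] Pb Pg.
by have /hasPn/(_ gamma Pg) := ind Pb.
Qed.

Lemma nonsimple_decomp alpha :
    alpha \in P -> alpha \notin simple_roots P ->
  exists beta gamma, [/\ beta \in P, gamma \in P & alpha = beta + gamma].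
Proof.
move=> Pa; rewrite mem_filter Pa andbT negbK => /hasP[b Pb /hasP[c Pc /eqP ->]].
by exists b, c.
Qed.

Lemma pos_neq_multiple alpha beta (k : nat) :
  alpha \in P -> beta \in P -> beta != alpha -> beta != k%:R *: alpha.
Proof.
move=> Pa Pb ne; case: k => [|[|k]]; rewrite ?scale0r ?scale1r //.
  exact: root_neq0 (pos_root Pb).
by apply: contraTneq (pos_root Pb) => ->; apply: root_multiple (pos_root Pa).
Qed.

Lemma pos_add_multiple alpha beta (k : nat) :
  alpha \in P -> beta \in P -> beta + k%:R *: alpha != 0.
Proof.
move=> Pa Pb; apply/eqP => /(canRL (addrK _)); rewrite add0r => e.
have := rootN (pos_root Pb); rewrite e opprK; case: k e => [|[|k]] e.
- by rewrite scale0r => /root_neq0; rewrite eqxx.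
- by have := pos_oppF Pa; rewrite -[alpha]scale1r -e Pb.
by rewrite (negPf (root_multiple _ (pos_root Pa))).
Qed.

(** Follow the string from [beta] to its reflection. A downward step from a positive to a negative
    root would write [alpha] as a sum of two positive roots; upward steps stay positive by
    closure. *)
Lemma simple_reflection_pos alpha beta :
    alpha \in simple_roots P -> beta \in P -> beta != alpha ->
  reflection alpha (hc alpha) beta \in P.
Proof.
move=> Sa Pb ne; have Pa := simple_pos Sa; have [ra rb] := (pos_root Pa, pos_root Pb).
have [[n bE hn]|[n bE hn]] := root_chain ra rb.
  suffices hj j : (j <= n)%N -> beta - j%:R *: alpha \in P.
    by rewrite /reflection bE hj.
  elim: j => [|j IHj] lej; first by rewrite scale0r subr0.
  have := hn _ lej; rewrite subr_eq0 (pos_neq_multiple _ Pa) // => /(_ isT) rj.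
  have [//|Pj] := root_posVneg rj.
  have := simple_indecomp Sa (IHj (ltnW lej)) Pj; rewrite opprB -natr1 scalerDl scale1r.
  by rewrite addrC addrA subrK addrC addKr eqxx.
suffices hj j : (j <= n)%N -> beta + j%:R *: alpha \in P.
  by rewrite /reflection bE scaleNr opprK hj.
elim: j => [|j IHj] lej; first by rewrite scale0r addr0.
have := hn _ lej; rewrite pos_add_multiple // -natr1 scalerDl scale1r addrA => /(_ isT).
by apply: pos_add => //; apply: IHj (ltnW lej).
Qed.

(** * The grading of the algebra by the half sum of the positive coroots *)

Definition half_coroots : subvs_of h := 2%:R^-1 *: \sum_(alpha <- P) hc alpha.

Lemma half_corootsE : vsval half_coroots = half_sum_coroots P hc.
Proof. by rewrite /half_coroots linearZ /= linear_sum. Qed.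

(* The simple reflection permutes the other positive roots and negates
   alpha on their coroots, so that only the coroot of alpha itself contributes. *)
Lemma simple_height alpha : alpha \in simple_roots P -> alpha half_coroots = 1 :> K.
Proof.
move=> Sa; have Pa := simple_pos Sa; have ra := pos_root Pa.
have [P_uniq _ _ _] := P_positive.
pose s := reflection alpha (hc alpha).
have sK : involutive s := reflectionK (coroot2 ra).
have s_rem b : b \in rem alpha P -> s b \in rem alpha P.
  rewrite !mem_rem_uniq // !inE => /andP[ne Pb]; rewrite simple_reflection_pos // andbT.
  apply: contraNneq (pos_oppF Pb) => sb; rewrite -(sK b) sb /s /reflection coroot2 //.
  by rewrite opprB scaler_nat mulr2n addrK.
have perm_s : perm_eq [seq s b | b <- rem alpha P] (rem alpha P).
  apply: uniq_perm; rewrite ?(map_inj_uniq (inv_inj sK)) ?rem_uniq // => b.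
  apply/mapP/idP => [[c /s_rem sc ->] //|/s_rem sb].
  by exists (s b) => //; rewrite sK.
pose S : K := \sum_(b <- rem alpha P) alpha (hc b).
have S0 : S = 0.
  have : S = - S.
    rewrite {1}/S -(perm_big _ perm_s) /= big_map -sumrN !big_seq; apply: eq_bigr => b Pb.
    by rewrite coroot_reflection // pos_root // (mem_rem Pb).
  by move/eqP; rewrite -addr_eq0 -mulr2n mulrn_eq0 /= => /eqP.
have -> : alpha half_coroots = 2^-1 * \sum_(b <- P) alpha (hc b) :> K.
  by rewrite /half_coroots linearZ /= linear_sum.
by rewrite (big_rem alpha) //= -/S S0 addr0 coroot2 // mulVf ?pnatr_eq0.
Qed.

Lemma pos_height alpha :
    alpha \in P ->
  exists2 k : nat, alpha half_coroots = k.+1%:R :> K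
    & alpha \notin simple_roots P -> (0 < k)%N.
Proof.
(* l lists roots known to exceed alpha by a sum of positive roots; it cannot
   grow forever inside P. *)
suffices: forall n alpha l, uniq l -> {subset l <= P} ->
    {in l, forall d, exists s : seq (weight h),
       [/\ s != [::], {subset s <= P} & d = alpha + \sum_(b <- s) b]} ->
    (size P < n + size l)%N -> alpha \in P ->
    exists2 k : nat, alpha half_coroots = k.+1%:R :> K
      & alpha \notin simple_roots P -> (0 < k)%N.
  by move/(_ (size P).+1 alpha [::]); apply; rewrite // addn0.
elim=> [|n IHn] {}alpha l l_uniq lP l_above ltn Pa.
  by have := leq_trans ltn (uniq_leq_size l_uniq lP); rewrite ltnn.
have lNa : alpha \notin l.
  apply/negP => /l_above[s [s0 sP aE]]; have /eqP := pos_sum_neq0 s0 sP; apply.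
  by apply: (@addrI _ alpha); rewrite addr0.
have [Sa|NSa] := boolP (alpha \in simple_roots P).
  by exists 0%N => //; rewrite simple_height.
have [b [c [Pb Pc aE]]] := nonsimple_decomp Pa NSa.
have IH d d' : d \in P -> d' \in P -> alpha = d + d' ->
    exists2 k : nat, d half_coroots = k.+1%:R :> K & d \notin simple_roots P -> (0 < k)%N.
  (* Each summand recurses with [alpha] added to the list: [alpha] exceeds [d] by [d'], and so every
     root of [l] exceeds [d] as well. *)
  move=> Pd Pd' E; apply: (IHn d (alpha :: l)) => //=.
  - by rewrite lNa.
  - by move=> e; rewrite inE => /predU1P[->|/lP].
  - move=> e; rewrite inE => /predU1P[->|/l_above[s [s0 sP ->]]].
      exists [:: d']; rewrite big_seq1; split=> // e'.
      by rewrite inE => /eqP->.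
    exists (d' :: s); rewrite big_cons addrA -E; split=> // e'.
    by rewrite inE => /predU1P[->|/sP].
  by rewrite addnS -addSn.
have [k kE _] := IH b c Pb Pc aE.
have [l' lE _] := IH c b Pc Pb (etrans aE (addrC b c)).
exists (k + l').+1 => //; rewrite aE add_lfunE kE lE.
by rewrite -[LHS]/((k.+1%:R : K) + l'.+1%:R) -natrD addSn addnS.
Qed.

Definition weights : seq (weight h) := 0 :: P ++ [seq - beta | beta <- P].

Lemma root_space_decomp_pos : (\sum_(lam <- weights) root_space lam)%VS = fullv.
Proof.
apply: (root_space_decomp h_cartan) => lam.
have [->|nz] := eqVneq (root_space lam) 0%VS; first exact: sub0v.
apply: (sumv_sup_seq (fun mu => root_space mu)) => //; rewrite inE.
by have [//|l0] := eqVneq lam 0; rewrite root_mem // /is_root l0.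
Qed.

Lemma height_eigen (c : K) v (W : {vspace g}) :
    [lie vsval half_coroots, v] = c *: v ->
    {in weights, forall lam, lam half_coroots = c :> K -> (root_space lam <= W)%VS} ->
  v \in W.
Proof.
move=> av hW.
have : v \in (\sum_(lam <- weights | (lam half_coroots : K) == c) root_space lam)%VS.
  apply: (@sum_eigen_eq _ _ (ad (vsval half_coroots))); last by rewrite adE.
    by move=> lam u ul; rewrite adE (root_space_weight _ ul).
  by rewrite root_space_decomp_pos memvf.
by apply/subvP/subv_big_seq => lam Dl /eqP; apply: hW.
Qed.

(** No root vanishes on the half sum: positive roots have positive values and their opposites
    negative ones. *)
Lemma height_eigen0 v : [lie vsval half_coroots, v] = 0 -> v \in h.
Proof.
move=> av; apply: (@height_eigen 0) => [|lam]; first by rewrite scale0r.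
rewrite inE mem_cat => /predU1P[-> _|/orP[/pos_height[k -> _]|/mapP[b Pb ->]]].
- by rewrite root_space0 ?subvv.
- by move/eqP; rewrite pnatr_eq0.
have [k kE _] := pos_height Pb; rewrite weightN kE => /eqP.
by rewrite oppr_eq0 pnatr_eq0.
Qed.

Lemma height_eigen1 v :
  [lie vsval half_coroots, v] = v -> v \in root_sum (simple_roots P).
Proof.
move=> av; apply: (@height_eigen 1) => [|lam]; first by rewrite scale1r.
rewrite inE mem_cat => /predU1P[->|/orP[Pl|/mapP[b Pb ->]]].
- by rewrite zero_lfunE => /esym/eqP; rewrite oner_eq0.
- have [k -> kS] := pos_height Pl => /eqP; rewrite pnatr_eq1 eqSS => /eqP k0.
  apply: sumv_sup_seq => //; apply: contraT => /kS; by rewrite k0.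
have [k kE _] := pos_height Pb; rewrite weightN kE => /eqP.
by rewrite eqr_oppLR -subr_eq0 opprK natr1 pnatr_eq0.
Qed.

Lemma height_eigenN1 v :
    [lie vsval half_coroots, v] = - v ->
  v \in root_sum [seq - alpha | alpha <- simple_roots P].
Proof.
move=> av; apply: (@height_eigen (- 1)) => [|lam]; first by rewrite scaleN1r.
rewrite inE mem_cat => /predU1P[->|/orP[Pl|/mapP[b Pb ->]]].
- by rewrite zero_lfunE => /esym/eqP; rewrite oppr_eq0 oner_eq0.
- have [k -> _] := pos_height Pl => /eqP.
  by rewrite -subr_eq0 opprK natr1 pnatr_eq0.
have [k kE kS] := pos_height Pb; rewrite weightN kE => /oppr_inj/eqP.
rewrite pnatr_eq1 eqSS => /eqP k0.
apply: sumv_sup_seq => //; rewrite map_f //; apply: contraT => /kS; by rewrite k0.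
Qed.

Lemma root_sum_height (s : seq (weight h)) (c : K) v :
    {in s, forall alpha, alpha half_coroots = c :> K} -> v \in root_sum s ->
  [lie vsval half_coroots, v] = c *: v.
Proof.
move=> hs vs; suffices: v \in lker (ad (vsval half_coroots) - c *: \1%VF).
  by rewrite memv_ker add_lfunE opp_lfunE scale_lfunE id_lfunE adE subr_eq0 => /eqP.
move: vs; apply/subvP/subv_big_seq => a sa _; apply/subvP => u ua.
rewrite memv_ker add_lfunE opp_lfunE scale_lfunE id_lfunE adE (root_space_weight _ ua).
by rewrite hs // subrr.
Qed.

(** If [alpha - beta] were a root, then, according to its sign, [alpha] or [beta] would be a sum of
    two positive roots. *)
Lemma lie_simple_x alpha beta :
    alpha \in simple_roots P -> beta \in simple_roots P -> alpha != beta ->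
  [lie x alpha, x (- beta)] = 0.
Proof.
move=> Sa Sb ne; have [Pa Pb] := (simple_pos Sa, simple_pos Sb).
have [ra rb] := (pos_root Pa, pos_root Pb).
apply/eqP; apply: contraT => nz.
have : is_root (alpha - beta).
  apply: root_space_root nz _ _; last by rewrite subr_eq0.
  by apply: root_space_lie; apply: xP => //; apply: rootN.
case/root_posVneg => [Pd|].
  by have := simple_indecomp Sa Pb Pd; rewrite addrC subrK eqxx.
rewrite opprB => Pd.
by have := simple_indecomp Sb Pa Pd; rewrite addrC subrK eqxx.
Qed.

Lemma lie_principal (r : weight h -> K) :
    half_sum_coroots P hc = \sum_(alpha <- simple_roots P) r alpha *: vsval (hc alpha) ->
  [lie principal_X P r x, principal_Y P r x] = - vsval half_coroots.
Proof.
move=> r_coef; have [P_uniq _ _ _] := P_positive.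
rewrite half_corootsE r_coef -sumrN /principal_X lie_suml !big_seq; apply: eq_bigr => a Sa.
rewrite /principal_Y linear_sum /= (bigD1_seq a) ?filter_uniq //= big_seq_cond big1.
  rewrite addr0 lieZl lieZr scalerA -expr2 sqrtCK lie_xx ?scalerN //.
  exact: pos_root (simple_pos Sa).
by move=> b /andP[Sb ne]; rewrite lieZl lieZr lie_simple_x 1?eq_sym // !scaler0.
Qed.

(** * Action of the involution on the Cartan subalgebra, the longest root and the grading *)

Section Involution.
Variables (r : weight h -> K) (sigma : 'End(g)) (eta : weight h).
Hypothesis r_coef : half_sum_coroots P hc
                    = \sum_(alpha <- simple_roots P) r alpha *: vsval (hc alpha).
Hypothesis sigma_KH : kostant_hitchin_involution P r x sigma.
Hypothesis eta_longest : longest_root P eta.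

Lemma sigma_lie u v : sigma [lie u, v] = [lie sigma u, sigma v].
Proof. by have [[_ ->]] := sigma_KH. Qed.

(** Since [sigma] is injective, an inclusion of the image is an equality by dimension. *)
Lemma sigma_img_eq (U : {vspace g}) :
  {in U, forall u, sigma u \in U} -> (sigma @: U)%VS = U.
Proof.
have [[ker0 _] _ _] := sigma_KH; move=> sU; apply/eqP.
rewrite eqEdim limg_dim_eq ?ker0 ?capv0 // leqnn andbT.
by apply/subvP => _ /memv_imgP[u uU ->]; apply: sU.
Qed.

Lemma sigma_half_coroots : sigma (vsval half_coroots) = vsval half_coroots.
Proof.
have [_ sX sY] := sigma_KH; apply: oppr_inj; rewrite -linearN /= -(lie_principal r_coef).
rewrite sigma_lie sY sX ?linearN /= ?lieNl ?opprK //.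
by rewrite memv_ker adE lie_bracket_alt.
Qed.

Lemma sigma_cartan v : v \in h -> sigma v \in h.
Proof.
have [h_ab _ _] := h_cartan; move=> hv; apply: height_eigen0.
by rewrite -sigma_half_coroots -sigma_lie h_ab ?subvsP // linear0.
Qed.

Let Peta : eta \in P. Proof. by case: eta_longest. Qed.
Let reta : is_root eta. Proof. exact: pos_root. Qed.

Lemma sigma_x_longest : sigma (x eta) = - x eta.
Proof.
have [_ sX _] := sigma_KH; have [_ hl] := eta_longest.
apply: sX; rewrite memv_ker adE /principal_X lie_suml big_seq big1 // => b Sb.
rewrite lieZl; suffices -> : [lie x b, x eta] = 0 by rewrite scaler0.
have Pb := simple_pos Sb; apply/eqP; apply: contraNT (hl b Pb) => nz.
apply: root_space_root nz _ (pos_add_neq0 Pb Peta).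
by apply: root_space_lie; apply: xP => //; apply: pos_root.
Qed.

(** Apply [sigma] to [[u, x eta] = eta(u) x eta]: the sign from [sigma (x eta) = - x eta] occurs on
    both sides and cancels. *)
Lemma longest_sigma u : u \in h -> eta (vsproj h (sigma u)) = eta (vsproj h u) :> K.
Proof.
move=> hu; apply/eqP; rewrite -subr_eq0; have := x_neq0 reta; apply: contraNT => nz.
suffices : (eta (vsproj h (sigma u)) - eta (vsproj h u)) *: x eta == 0.
  by rewrite scaler_eq0 (negPf nz).
have ux : [lie u, x eta] = (eta (vsproj h u) : K) *: x eta.
  by rewrite -{1}(vsprojK hu) (root_space_weight _ (xP reta)).
rewrite scalerBl -ux -(root_space_weight _ (xP reta)) vsprojK ?sigma_cartan //.
have -> : [lie sigma u, x eta] = - sigma [lie u, x eta].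
  by rewrite sigma_lie sigma_x_longest linearN /= opprK.
by rewrite ux linearZ /= sigma_x_longest scalerN opprK subrr.
Qed.

(** Every [H] is [sigma w] for some [w] in [h], and [eta] agrees on the two. The scalar [c] covers
    [eta] and [- eta] at once. *)
Lemma sigma_root_space_longest (c : K) u :
  u \in root_space (c *: eta) -> sigma u \in root_space (c *: eta).
Proof.
move=> hu; apply/root_spaceP => H.
have : vsval H \in (sigma @: h)%VS by rewrite (sigma_img_eq sigma_cartan) subvsP.
case/memv_imgP => w hw HE.
have -> : H = vsproj h (sigma w) by apply: subvs_inj; rewrite vsprojK ?sigma_cartan.
rewrite vsprojK ?sigma_cartan // -sigma_lie -{1}(vsprojK hw) (root_space_weight _ hu).
rewrite linearZ /= !scale_lfunE; congr (_ *: _).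
by rewrite -[LHS]/(c * eta (vsproj h w)) -longest_sigma.
Qed.

Lemma sigma_coroot_longest : sigma (vsval (hc eta)) = vsval (hc eta).
Proof.
have [c sx] : exists c, sigma (x (- eta)) = c *: x (- eta).
  apply: root_space_line; first exact: rootN.
  by rewrite -scaleN1r sigma_root_space_longest // scaleN1r xP // rootN.
have hE : sigma (vsval (hc eta)) = - c *: vsval (hc eta).
  apply: oppr_inj; rewrite -linearN /= -lie_xx // sigma_lie sx sigma_x_longest.
  by rewrite lieNl lieZr lie_xx // scalerN scaleNr opprK.
have hcE : vsproj h (sigma (vsval (hc eta))) = 0 - c *: hc eta.
  by apply: subvs_inj; rewrite hE vsprojK ?memvZ ?subvsP // sub0r -scaleNr.
(* Evaluating [eta] on both sides gives [- c * 2 = 2], hence [c = - 1]. *)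
have := longest_sigma (subvsP (hc eta)); rewrite hcE weightBZ vsvalK coroot2 // linear0.
rewrite sub0r -mulNr -[RHS]mul1r => /mulIf c1.
by rewrite hE c1 ?scale1r // pnatr_eq0.
Qed.

(** The simple root spaces together form the eigenspace for 1 of the bracket with the half sum,
    which [sigma] fixes; the line of [- eta] is treated separately. *)
Lemma sigma_Zdagger :
  (sigma @: root_sum (Zdagger P eta))%VS = root_sum (Zdagger P eta).
Proof.
rewrite /root_sum /Zdagger big_cons limgD; congr (_ + _)%VS.
  by apply: sigma_img_eq => u; rewrite -scaleN1r; apply: sigma_root_space_longest.
apply: sigma_img_eq => u uS; apply: height_eigen1.
rewrite -sigma_half_coroots -sigma_lie (root_sum_height (c := 1) _ uS) ?scale1r //.
exact: simple_height.
Qed.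

Lemma sigma_Zset : (sigma @: root_sum (Zset P eta))%VS = root_sum (Zset P eta).
Proof.
rewrite /root_sum /Zset /= opprK big_cons limgD; congr (_ + _)%VS.
  by apply: sigma_img_eq => u; rewrite -[eta]scale1r; apply: sigma_root_space_longest.
apply: sigma_img_eq => u uS; apply: height_eigenN1.
rewrite -sigma_half_coroots -sigma_lie (root_sum_height (c := - 1) _ uS) ?scaleN1r ?linearN //.
by move=> _ /mapP[b Sb ->]; rewrite weightN simple_height.
Qed.

End Involution.
End RootSystem.

Theorem proposition2p5p4 (R : realType) (g : lieAlgType R[i])
    (h : {vspace g}) (P : seq (weight h)) (hc : weight h -> subvs_of h)
    (x : weight h -> g) (r : weight h -> R[i]) (sigma : 'End(g))
    (eta : weight h)
    (g_simple : lie_simple g)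
    (h_cartan : cartan_subalgebra h)
    (P_positive : positive_system P)
    (hc_coroot : forall alpha, is_root alpha -> is_coroot alpha (hc alpha))
    (x_chevalley : chevalley_base hc x)
    (r_coef : half_sum_coroots P hc
              = \sum_(alpha <- simple_roots P) r alpha *: vsval (hc alpha))
    (sigma_KH : kostant_hitchin_involution P r x sigma)
    (eta_longest : longest_root P eta) :
  sigma (x eta) = - x eta /\
  sigma (vsval (hc eta)) = vsval (hc eta) /\
  (sigma @: root_sum (Zset P eta))%VS = root_sum (Zset P eta) /\
  (sigma @: root_sum (Zdagger P eta))%VS = root_sum (Zdagger P eta).
Proof.
split; first exact: (sigma_x_longest P_positive x_chevalley sigma_KH eta_longest).
split; first exact: (sigma_coroot_longest h_cartan P_positive hc_coroot x_chevalley
                       r_coef sigma_KH eta_longest).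
split; first exact: (sigma_Zset h_cartan P_positive hc_coroot x_chevalley
                       r_coef sigma_KH eta_longest).
exact: (sigma_Zdagger h_cartan P_positive hc_coroot x_chevalley
          r_coef sigma_KH eta_longest).
Qed.
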